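(* Let $F_2$ be the free group on two generators. Then the holomorph $\mathrm{Hol}(F_2)$ is linear.
   Context: The holomorph of a group $G$, denoted $\mathrm{Hol}(G)$, is the universal split extension $1 \to G \to \mathrm{Hol}(G) \to \mathrm{Aut}(G) \to 1$, i.e. the semidirect product $G \rtimes \mathrm{Aut}(G)$ in which $\mathrm{Aut}(G)$ acts on $G$ in the obvious way (by evaluation of automorphisms). A group is called linear if it admits a faithful, finite-dimensional representation in $GL(m,k)$ for some $m$ and some field $k$ of characteristic zero. *)

(* Defs.v *)
From HB Require Import structures.
From mathcomp Require Import all_boot all_algebra.
From mathcomp Require Import boolp.

Set Implicit Arguments.
Unset Strict Implicit.
Unset Printing Implicit Defensive.

Import GRing.Theory.
Local Open Scope group_scope.

(* The free group on T is realised as the set of reduced words, the product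
   being concatenation followed by reduction. Its universal property is given
   by fg_extE and fg_ext_uniq below. *)
Section FreeGroup.
Variable T : choiceType.

(* The letter (t, false) stands for the generator t, and (t, true) for its
   inverse. *)
Definition inv_letter (x : T * bool) : T * bool := (x.1, ~~ x.2).

Definition reduced (w : seq (T * bool)) : bool :=
  sorted (fun x y => y != inv_letter x) w.

Record free_group := FreeGroup {
  word_of :> seq (T * bool);
  word_of_reduced : reduced word_of }.

HB.instance Definition _ := [isSub for word_of].
HB.instance Definition _ := [Choice of free_group by <:].

(* w is meant to be reduced; then so is letter_mul x w. *)
Definition letter_mul (x : T * bool) (w : seq (T * bool)) :=
  if w is y :: w' then if y == inv_letter x then w' else x :: w else [:: x].

Lemma inv_letterK : involutive inv_letter.
Proof. by case=> t b; rewrite /inv_letter /= negbK. Qed.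

Lemma letter_mul_reduced x w : reduced w -> reduced (letter_mul x w).
Proof.
case: w => //= y w; case: (eqVneq y (inv_letter x)) => [_ | nxy] /= Hw.
  exact: path_sorted Hw.
by rewrite nxy.
Qed.

Lemma foldr_reduced u w : reduced w -> reduced (foldr letter_mul w u).
Proof. by move=> Hw; elim: u => //= x u; apply: letter_mul_reduced. Qed.

Lemma letter_mulK x w :
  reduced w -> letter_mul (inv_letter x) (letter_mul x w) = w.
Proof.
case: w => [|y w] /=; first by rewrite inv_letterK eqxx.
case: (eqVneq y (inv_letter x)) => [-> | nxy] /= Hw.
  by case: w Hw => //= z w /andP[/negPf-> _].
by rewrite inv_letterK eqxx.
Qed.

Lemma foldr_letter_mul x u w : reduced w ->
  foldr letter_mul w (letter_mul x u) = letter_mul x (foldr letter_mul w u).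
Proof.
move=> Hw; case: u => //= y u; case: (eqVneq y (inv_letter x)) => [-> | //] /=.
have := letter_mulK (inv_letter x) (foldr_reduced u Hw).
by rewrite inv_letterK => ->.
Qed.

Definition fg_one : free_group := FreeGroup (isT : reduced [::]).
Definition fg_mul (u v : free_group) : free_group :=
  FreeGroup (foldr_reduced u (word_of_reduced v)).

Lemma rev_inv_reduced (u : free_group) : reduced (rev (map inv_letter u)).
Proof.
rewrite /reduced rev_sorted sorted_map.
apply: sub_sorted (word_of_reduced u) => x y /=.
by rewrite /relpre /= inv_letterK eq_sym.
Qed.
Definition fg_inv (u : free_group) : free_group :=
  FreeGroup (rev_inv_reduced u).

Lemma fg_mulA : associative fg_mul.
Proof.
move=> u v w; apply: val_inj => /=; elim: (word_of u) => //= x s ->.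
by rewrite foldr_letter_mul // word_of_reduced.
Qed.

Lemma fg_mul1 : left_id fg_one fg_mul.
Proof. by move=> u; apply: val_inj. Qed.

Lemma foldr_reducedE w : reduced w -> foldr letter_mul [::] w = w.
Proof.
elim: w => //= x w IHw Hw; rewrite IHw; last exact: path_sorted Hw.
by case: w Hw {IHw} => //= y w /andP[/negPf-> _].
Qed.

Lemma fg_mulg1 : right_id fg_one fg_mul.
Proof. by move=> u; apply: val_inj; apply: foldr_reducedE (valP u). Qed.

Lemma fg_mulVg : left_inverse fg_one fg_inv fg_mul.
Proof.
move=> u; apply: val_inj => /=; elim: (word_of u) (word_of_reduced u) => //= x s IH Hs.
have Hs' : reduced s by exact: path_sorted Hs.
rewrite rev_cons -cats1 foldr_cat /= -[RHS]IH //; congr foldr.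
have := letter_mulK x Hs'.
by case: s Hs {IH Hs'} => //= y s /andP[/negPf-> _].
Qed.

Lemma fg_mulgV : right_inverse fg_one fg_inv fg_mul.
Proof.
move=> u; rewrite -{1}[u](_ : fg_inv (fg_inv u) = u) ?fg_mulVg //.
apply: val_inj => /=; rewrite map_rev revK -map_comp -[RHS]map_id.
by apply: eq_map => x /=; rewrite inv_letterK.
Qed.

HB.instance Definition _ := isGroup.Build free_group
  fg_mulA fg_mul1 fg_mulg1 fg_mulVg fg_mulgV.

Definition fg_gen (t : T) : free_group :=
  FreeGroup (isT : reduced [:: (t, false)]).

Section Universal.
Variables (G : groupType) (f : T -> G).

Definition letter_eval (x : T * bool) : G := if x.2 then (f x.1)^-1 else f x.1.
Definition fg_ext (u : free_group) : G :=
  foldr (fun x g => letter_eval x * g) 1 u.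

Lemma letter_evalV x : letter_eval (inv_letter x) = (letter_eval x)^-1.
Proof. by case: x => t [] //=; rewrite /letter_eval /= invgK. Qed.

Lemma fg_extM : {morph fg_ext : u v / u * v}.
Proof.
move=> u v; rewrite /fg_ext /=; elim: (word_of u) => [|x s IH] /=.
  by rewrite mul1g.
rewrite -mulgA -{}IH; case: (foldr _ _ s) => //= y w.
by case: eqVneq => //= ->; rewrite letter_evalV mulgA mulgV mul1g.
Qed.

HB.instance Definition _ := isMultiplicative.Build free_group G fg_ext fg_extM.

Lemma fg_extE t : fg_ext (fg_gen t) = f t.
Proof. exact: mulg1. Qed.

Lemma fg_ext_uniq (h : {multiplicative free_group -> G}) :
  (forall t, h (fg_gen t) = f t) -> h =1 fg_ext.
Proof.
move=> hf [w Hw]; rewrite /fg_ext /=.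
have h1 : h 1 = 1 by apply: (@mulgI _ (h 1)); rewrite -gmulfM !mulg1.
elim: w Hw => [|x w IH] Hw /=.
  by rewrite -[RHS]h1; congr (h _); apply: val_inj.
have Hw' : reduced w by exact: path_sorted Hw.
have Hx : reduced [:: x] by [].
rewrite -(IH Hw') (_ : FreeGroup Hw = FreeGroup Hx * FreeGroup Hw'); last first.
  by apply: val_inj => /=; case: w Hw {IH Hw'} => //= y w /andP[/negPf-> _].
rewrite gmulfM; congr (_ * _); case: x Hx {Hw} => t [] Hx; last first.
  by rewrite /letter_eval /= -hf; congr (h _); apply: val_inj.
apply: (@mulgI _ (f t)); rewrite /letter_eval /= mulgV -hf -gmulfM -[RHS]h1.
by congr (h _); apply: val_inj; rewrite /= /inv_letter eqxx.
Qed.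
End Universal.
End FreeGroup.

Definition F2 : groupType := free_group 'I_2.

Section Aut.
Variable G : groupType.

Record aut := Aut {
  aut_fun :> G -> G;
  aut_morph : {morph aut_fun : x y / x * y};
  aut_bij : bijective aut_fun }.

HB.instance Definition _ := gen_eqMixin aut.
HB.instance Definition _ := gen_choiceMixin aut.

Lemma aut_eq (f g : aut) : f =1 g -> f = g.
Proof.
case: f g => [f fM fB] [g gM gB] /= /funext fg.
by subst g; congr Aut; apply: Prop_irrelevance.
Qed.

Definition aut_one : aut :=
  Aut (fun x y => erefl : idfun (x * y) = idfun x * idfun y)
      (Bijective (fun=> erefl) (fun=> erefl)).

Lemma aut_mul_morph (f g : aut) : {morph f \o g : x y / x * y}.
Proof. by move=> x y /=; rewrite !aut_morph. Qed.
(* Automorphisms act on the left: (f * g) x = f (g x). *)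
Definition aut_mul (f g : aut) : aut :=
  Aut (aut_mul_morph f g) (bij_comp (aut_bij f) (aut_bij g)).

Lemma aut_surj (f : aut) y : exists x, f x == y.
Proof. by case: (aut_bij f) => g _ gK; exists (g y); rewrite gK. Qed.
Definition aut_invf (f : aut) (y : G) : G := xchoose (aut_surj f y).
Lemma aut_invfK (f : aut) : cancel (aut_invf f) f.
Proof. by move=> y; apply/eqP/(xchooseP (aut_surj f y)). Qed.
Lemma aut_funK (f : aut) : cancel f (aut_invf f).
Proof. by move=> x; apply: (bij_inj (aut_bij f)); rewrite aut_invfK. Qed.
Lemma aut_inv_morph (f : aut) : {morph aut_invf f : x y / x * y}.
Proof.
by move=> x y; apply: (bij_inj (aut_bij f)); rewrite aut_morph !aut_invfK.
Qed.
Definition aut_inv (f : aut) : aut :=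
  Aut (aut_inv_morph f) (Bijective (aut_invfK f) (aut_funK f)).

Lemma aut_mulA : associative aut_mul.
Proof. by move=> f g h; apply: aut_eq. Qed.
Lemma aut_mul1g : left_id aut_one aut_mul.
Proof. by move=> f; apply: aut_eq. Qed.
Lemma aut_mulg1 : right_id aut_one aut_mul.
Proof. by move=> f; apply: aut_eq. Qed.
Lemma aut_mulVg : left_inverse aut_one aut_inv aut_mul.
Proof. by move=> f; apply: aut_eq => x; apply: aut_funK. Qed.
Lemma aut_mulgV : right_inverse aut_one aut_inv aut_mul.
Proof. by move=> f; apply: aut_eq => x; apply: aut_invfK. Qed.

HB.instance Definition _ := isGroup.Build aut
  aut_mulA aut_mul1g aut_mulg1 aut_mulVg aut_mulgV.

Lemma autM (f g : aut) x : (f * g) x = f (g x). Proof. by []. Qed.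
Lemma aut1E x : (1 : aut) x = x. Proof. by []. Qed.
Lemma autf1 (f : aut) : f 1 = 1.
Proof. by apply: (@mulgI _ (f 1)); rewrite -aut_morph !mulg1. Qed.
End Aut.

Section Hol.
Variable G : groupType.

(* A new type rather than G * aut G, since the latter already carries the
   structure of the direct product. *)
Record hol := Hol { hol_elt : G; hol_aut : aut G }.

HB.instance Definition _ := gen_eqMixin hol.
HB.instance Definition _ := gen_choiceMixin hol.

Definition hol_one : hol := Hol 1 1.
Definition hol_mul (u v : hol) : hol :=
  Hol (hol_elt u * hol_aut u (hol_elt v)) (hol_aut u * hol_aut v).
Definition hol_inv (u : hol) : hol :=
  Hol ((hol_aut u)^-1 (hol_elt u)^-1) (hol_aut u)^-1.

Lemma hol_mulA : associative hol_mul.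
Proof.
by move=> [a f] [b g] [c h]; rewrite /hol_mul /= aut_morph !mulgA.
Qed.
Lemma hol_mul1g : left_id hol_one hol_mul.
Proof. by move=> [a f]; rewrite /hol_mul /= !mul1g. Qed.
Lemma hol_mulg1 : right_id hol_one hol_mul.
Proof. by move=> [a f]; rewrite /hol_mul /= autf1 !mulg1. Qed.
Lemma hol_mulVg : left_inverse hol_one hol_inv hol_mul.
Proof.
move=> [a f]; congr Hol; last exact: mulVg.
by have /esym := aut_morph f^-1 a^-1 a; rewrite mulVg autf1.
Qed.
Lemma hol_mulgV : right_inverse hol_one hol_inv hol_mul.
Proof.
move=> [a f]; congr Hol; last exact: mulgV.
by have := congr1 ( *%g a) (aut_invfK f a^-1); rewrite mulgV.
Qed.

HB.instance Definition _ := isGroup.Build hol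
  hol_mulA hol_mul1g hol_mulg1 hol_mulVg hol_mulgV.
End Hol.

(* The library's {'GL_n[R]} requires R to be finite. *)
Section GL.
Variables (m : nat) (k : fieldType).

Record GL := GLmx { mx_of_GL :> 'M[k]_m; mx_of_GL_unit : mx_of_GL \in unitmx }.

HB.instance Definition _ := [isSub for mx_of_GL].
HB.instance Definition _ := [Choice of GL by <:].

Definition GL_one : GL := GLmx (unitmx1 k m).
Lemma GL_mul_unit (A B : GL) : (A *m B)%R \in unitmx.
Proof. by rewrite unitmx_mul !mx_of_GL_unit. Qed.
Definition GL_mul (A B : GL) : GL := GLmx (GL_mul_unit A B).
Lemma GL_inv_unit (A : GL) : invmx A \in unitmx.
Proof. by rewrite unitmx_inv mx_of_GL_unit. Qed.
Definition GL_inv (A : GL) : GL := GLmx (GL_inv_unit A).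

Lemma GL_mulA : associative GL_mul.
Proof. by move=> A B C; apply: val_inj; apply: mulmxA. Qed.
Lemma GL_mul1g : left_id GL_one GL_mul.
Proof. by move=> A; apply: val_inj; apply: mul1mx. Qed.
Lemma GL_mulg1 : right_id GL_one GL_mul.
Proof. by move=> A; apply: val_inj; apply: mulmx1. Qed.
Lemma GL_mulVg : left_inverse GL_one GL_inv GL_mul.
Proof. by move=> A; apply: val_inj; apply: mulVmx (mx_of_GL_unit A). Qed.
Lemma GL_mulgV : right_inverse GL_one GL_inv GL_mul.
Proof. by move=> A; apply: val_inj; apply: mulmxV (mx_of_GL_unit A). Qed.

HB.instance Definition _ := isGroup.Build GL
  GL_mulA GL_mul1g GL_mulg1 GL_mulVg GL_mulgV.
End GL.

Definition linear_group (G : groupType) : Prop :=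
  exists (m : nat) (k : fieldType) (rho : {multiplicative G -> GL m k}),
    [pchar k]%R =i pred0 /\ injective rho.

(* Main.v *)
Require Import Defs.
From HB Require Import structures.
From mathcomp Require Import all_boot all_order all_algebra.
From mathcomp Require Import boolp ring zify.

Set Implicit Arguments.
Unset Strict Implicit.
Unset Printing Implicit Defensive.

Import Order.TTheory GRing.Theory Num.Theory.
Local Open Scope group_scope.

(** Hol(F2) acts on the set F2 by (g, phi) . h = g * phi h, and only the identity
    acts trivially. Suppose that D is a faithful representation of F2 such
    that D o phi is conjugate to D for every automorphism phi. Then the linear
    relations between the matrices D h are preserved by this action, which
    therefore extends to a linear action of Hol(F2) on the span of the D h,
    still faithful because D is injective ([hol_linear]). It remains to find
    such a D.

    It comes from the braid group B4. There a = s1 s3^-1 and b = s2 a s2^-1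
    generate a normal subgroup: conjugation by s1^-1 fixes a and sends b to
    b a, and conjugation by s2 s1 s3 is the quarter turn a -> b, b -> a^-1.
    So, if rho is the restriction to words in a and b of a representation of
    B4, these two automorphisms carry rho to a conjugate of itself. The flip
    a -> a^-1, b -> b conjugates each of them to its inverse, so they also
    carry rho o flip to a conjugate of itself. Hence all three carry
    rho (+) rho o flip ([twin]) to a conjugate of itself. Together with the
    inner automorphisms they generate Aut(F2) ([Nielsen_F2]), and this is D.

    For rho to be faithful, take the Lawrence-Krammer representation over
    Q(t), at q = 1/2. At t = 0 its matrices are nonnegative, and the row of
    the i-th simple root in the matrix of a positive word vanishes if and
    only if the braid relations turn that word into one starting with s_i
    ([LK0_root_row], [LK0_row_initial]). A positive word can thus be read off
    its matrix letter by letter, up to the braid relations ([LK_faithful]).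
    This extends to all words, since a power of the central full twist makes
    any of them positive: a word h in a and b that is killed by rho has trivial
    value for every solution of the braid relations in a group. One such
    solution lies in Aut(F2), and there the value of h is conjugation by h
    ([braid_F2_B4_action]). As F2 has trivial center, h = 1. *)

(** * Homomorphisms and automorphisms of free groups *)

Lemma multiplicativeP (G H : groupType) (f : G -> H) :
  {morph f : x y / (x * y)%g} ->
  exists F : {multiplicative G -> H}, F =1 f.
Proof.
move=> fM.
by exists (HB.pack_for {multiplicative G -> H} f
             (isMultiplicative.Build G H f fM)).
Qed.

Lemma morphV (G H : groupType) (h : G -> H) :
  {morph h : x y / x * y} -> {morph h : x / x^-1}.
Proof.
move=> hM x; have h1 : h 1 = 1 by apply: (@mulgI _ (h 1)); rewrite -hM !mulg1.
by apply: (@mulgI _ (h x)); rewrite -hM !mulgV.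
Qed.

Lemma eq_on_gens (T : choiceType) (G : groupType) (h1 h2 : free_group T -> G) :
  {morph h1 : x y / x * y} -> {morph h2 : x y / x * y} ->
  (forall t, h1 (fg_gen t) = h2 (fg_gen t)) -> h1 =1 h2.
Proof.
move=> /multiplicativeP[m1 E1] /multiplicativeP[m2 E2] E x; rewrite -E1 -E2.
by rewrite (fg_ext_uniq (f := h2 \o @fg_gen T)) => [|t]; rewrite ?E1 ?E //;
  apply/esym/fg_ext_uniq => t; rewrite E2.
Qed.

Lemma fg_extV (T : choiceType) (G : groupType) (f : T -> G) :
  {morph fg_ext f : x / x^-1}.
Proof. exact: morphV (fg_extM f). Qed.

Lemma autV (G : groupType) (phi : aut G) : {morph phi : x / x^-1}.
Proof. exact: morphV (aut_morph phi). Qed.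

Lemma aut_inv_eq (G : groupType) (f : aut G) x y : f x = y -> f^-1 y = x.
Proof. by move=> <-; rewrite -autM mulVg. Qed.

Lemma aut_ext (T : choiceType) (phi psi : aut (free_group T)) :
  (forall t, phi (fg_gen t) = psi (fg_gen t)) -> phi = psi.
Proof.
by move=> E; apply: aut_eq; apply: eq_on_gens E; apply: aut_morph.
Qed.

Lemma ext_aut_bij (T : choiceType) (f g : T -> free_group T) :
  (forall t, fg_ext f (g t) = fg_gen t) ->
  (forall t, fg_ext g (f t) = fg_gen t) -> bijective (fg_ext f).
Proof.
move=> fg gf.
have K f1 g1 : (forall t, fg_ext g1 (f1 t) = fg_gen t) ->
    cancel (fg_ext f1) (fg_ext g1).
  move=> E; apply: (@eq_on_gens _ _ (fg_ext g1 \o fg_ext f1) id) => //=.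
    by move=> x y /=; rewrite !fg_extM.
  by move=> t; rewrite fg_extE.
by exists (fg_ext g); apply: K.
Qed.

Definition ext_aut (T : choiceType) (f g : T -> free_group T)
    (fg : forall t, fg_ext f (g t) = fg_gen t)
    (gf : forall t, fg_ext g (f t) = fg_gen t) : aut (free_group T) :=
  Aut (fg_extM f) (ext_aut_bij fg gf).

Section Inner.
Variables (G : groupType) (g : G).
Lemma inner_morph : {morph (fun x : G => g * x * g^-1) : x y / x * y}.
Proof. by move=> x y; rewrite !mulgA mulgVK. Qed.
Lemma inner_bij : bijective (fun x : G => g * x * g^-1).
Proof.
exists (fun x => g^-1 * x * g) => x;
by rewrite !mulgA ?(mulgV, mulVg, mul1g) ?mulgVK ?mulgK.
Qed.
Definition inner : aut G := Aut inner_morph inner_bij.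
End Inner.

Lemma innerM (G : groupType) : {morph @inner G : g h / g * h}.
Proof. by move=> g h; apply: aut_eq => x; rewrite /= invgM !mulgA. Qed.

Lemma inner_conj (G : groupType) (f : aut G) g : f * inner g * f^-1 = inner (f g).
Proof.
apply: aut_eq => x; rewrite !autM /= !aut_morph autV.
by rewrite -[f (f^-1 x)]autM mulgV.
Qed.

(** * Word length and cancellation in free groups *)

Section CommonPrefix.
Variable T : eqType.
Implicit Types u v w : seq T.

Fixpoint lcp u v : nat :=
  match u, v with
  | x :: u', y :: v' => if x == y then (lcp u' v').+1 else 0
  | _, _ => 0
  end.

Lemma lcpC u v : lcp u v = lcp v u.
Proof.
by elim: u v => [|x u IH] [|y v] //=; rewrite eq_sym IH.
Qed.

Lemma lcp_ultrametric u v w : (minn (lcp u v) (lcp v w) <= lcp u w)%N.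
Proof.
elim: u v w => [|x u IH] [|y v] [|z w] //=; rewrite ?minn0 ?min0n //.
case: eqVneq => [->|_]; last by rewrite min0n.
case: eqVneq => [_|_]; last by rewrite minn0.
by rewrite minnSS ltnS IH.
Qed.

Lemma lcp_le u v : (lcp u v <= size u)%N.
Proof. by elim: u v => [|x u IH] [|y v] //=; case: eqP => // _; rewrite ltnS. Qed.

Lemma lcp_take n u : (n <= size u)%N -> lcp (take n u) u = n.
Proof. by elim: u n => [|x u IH] [|n] //= le; rewrite eqxx IH. Qed.

Lemma lcp_nth x0 u v i : (i < lcp u v)%N -> nth x0 u i = nth x0 v i.
Proof.
elim: u v i => [|x u IH] [|y v] //= i; case: eqP => // -> .
by case: i => //= i; apply: IH.
Qed.
End CommonPrefix.

Section Length.
Variable T : choiceType.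
Local Notation FG := (free_group T : groupType).
Implicit Types x y z d : FG.

Definition len x := size (word_of x).
Arguments len x%_g.

(** The Gromov product based at 1 of two vertices of the Cayley tree. The
    number of letters that cancel in x * y is [gromov x^-1 y]. *)
Definition gromov x y := lcp (word_of x) (word_of y).
Arguments gromov (x y)%_g.

Lemma gromovC x y : gromov x y = gromov y x. Proof. exact: lcpC. Qed.

Lemma gromov_ultrametric x y z :
  (minn (gromov x y) (gromov y z) <= gromov x z)%N.
Proof. exact: lcp_ultrametric. Qed.

Lemma len_gromov x y : (len (x^-1 * y) + 2 * gromov x y = len x + len y)%N.
Proof.
case: x y => [u Hu] [v Hv]; rewrite /len /gromov /=.
elim: u v Hu Hv => [|a u IH] v Hu Hv; first by rewrite /= muln0 addn0.
have Hu' : reduced u := path_sorted Hu.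
rewrite /= rev_cons -cats1 foldr_cat /=.
have nocancel : reduced (inv_letter a :: v) ->
    (size (foldr (@letter_mul T) (inv_letter a :: v) (rev (map (@inv_letter T) u)))
     = size u + size v + 1)%N.
  move=> Hav; have := IH _ Hu' Hav.
  case: (u) Hu => [|b u'] /=; first by move=> _ ; lia.
  by move=> /andP[/negPf-> _] /=; lia.
case: v Hv nocancel => [|b v] Hv nocancel /=; first by rewrite nocancel //=; lia.
rewrite inv_letterK [a == b]eq_sym; case: eqVneq => [ab|neq].
  by have := IH v Hu' (path_sorted Hv); lia.
by rewrite nocancel /=; [lia | rewrite inv_letterK neq].
Qed.

Lemma lenV x : len x^-1 = len x.
Proof. by rewrite /len /= size_rev size_map. Qed.

Lemma len_eq0 x : (len x == 0)%N -> x = 1.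
Proof. by case: x => -[] //= H _; apply: val_inj. Qed.

Lemma len_gt0 x : x <> 1 -> (0 < len x)%N.
Proof. by move=> nx; rewrite lt0n; apply/negP => /len_eq0. Qed.

Lemma gromov_le x y : (gromov x y <= len x)%N.
Proof. exact: lcp_le. Qed.

Lemma len_mul x y : (len (x * y) + 2 * gromov x^-1 y = len x + len y)%N.
Proof. by rewrite -{1}[x]invgK len_gromov lenV. Qed.

Lemma gromov_mulr x y : (gromov x (x * y) + gromov x^-1 y = len x)%N.
Proof.
have := len_gromov x (x * y); rewrite mulgA mulVg mul1g.
by have := len_mul x y; lia.
Qed.

(** Otherwise x would begin with at least half of its own inverse; then its
    middle letter would be its own inverse, or its two middle letters would
    cancel. *)
Lemma gromovV_lt x : x <> 1 -> (2 * gromov x^-1 x < len x)%N.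
Proof.
move=> /len_gt0; case: x => [u Hu]; rewrite /len /gromov /= => u_gt0.
rewrite ltnNge; apply/negP => big.
case: u u_gt0 big Hu => // a0 u; set w := a0 :: u => w_gt0 big Hw.
have Hle : (lcp (rev (map (@inv_letter T) w)) w <= size w)%N.
  by rewrite lcpC lcp_le.
have nthE i : (i < lcp (rev (map (@inv_letter T) w)) w)%N ->
    nth a0 w i = inv_letter (nth a0 w (size w - i.+1)).
  move=> lti; rewrite -(lcp_nth a0 lti) nth_rev size_map; last lia.
  by rewrite (nth_map a0) //; lia.
move: (lcp _ w) big Hle nthE => c big le_c nthE.
have [h E] : exists h, size w = h.*2 \/ size w = h.*2.+1.
  by exists (size w)./2; lia.
have lt_hc : (0 < h -> h.-1 < c)%N by lia.
case: E => E.
  case: h E lt_hc => [|h] E lt_hc; first by rewrite E in w_gt0.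
  have := nthE h (lt_hc isT); rewrite (_ : size w - h.+1 = h.+1)%N; last lia.
  move=> wh; have lt_h : (h.+1 < size w)%N by lia.
  have /(sortedP a0)/(_ h lt_h) := Hw.
  by rewrite wh inv_letterK eqxx.
have lt_h : (h < c)%N by lia.
have := nthE h lt_h; rewrite (_ : size w - h.+1 = h)%N; last lia.
by case: (nth a0 w h) => t [] /(congr1 snd).
Qed.

(** Vertices at distance k from 1 on the common beginning of the geodesics from
    1 to x and to y. *)
Lemma prefix_exists x y k : (k <= gromov x y)%N ->
  exists d, [/\ len d = k, gromov d x = k & (k <= gromov d y)%N].
Proof.
move=> kxy; have kx : (k <= len x)%N := leq_trans kxy (gromov_le x y).
have red : reduced (take k x) by apply: take_sorted (word_of_reduced x).
have dx : gromov (FreeGroup red) x = k by rewrite /gromov lcp_take.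
exists (FreeGroup red); split=> //; first by rewrite /len /= size_takel.
by have := gromov_ultrametric (FreeGroup red) x y; lia.
Qed.

(** If some letter of y survives in x * y * z, then z does not influence the
    cancellation between x and y. *)
Lemma gromov_mul_stable x y z :
  (gromov x^-1 y + gromov y^-1 z < len y)%N ->
  gromov x^-1 (y * z) = gromov x^-1 y.
Proof.
have := gromov_mulr y z; have := gromov_ultrametric x^-1 y (y * z).
have := gromov_ultrametric x^-1 (y * z) y; rewrite [gromov (y * z) y]gromovC.
by lia.
Qed.

(* tie *)
(** The case that the length of products cannot decide: u = c d^-1 with c and d
    of the same length, and v = d m c^-1. Here v * u = d m d^-1 is not shorter
    than v, but conjugation by d turns the pair (u, v * u) into (d^-1 c, m). *)
Lemma tie_shortens (u v : FG) : u <> 1 -> 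
  (gromov v^-1 u + gromov v^-1 u = len u)%N ->
  (gromov u^-1 v + gromov u^-1 v = len u)%N ->
  (len u <= len v)%N ->
  exists d, (len (d^-1 * u * d) + len (d^-1 * (v * u) * d) < len u + len v)%N.
Proof.
move=> /len_gt0 u_gt0; move kE : (gromov v^-1 u) => k vu uv le_uv.
have uvk : gromov u^-1 v = k by lia.
have [d [dk du dv]] := @prefix_exists u^-1 v k ltac:(lia).
have dv' := gromov_le d v.
exists d.
move pE : (v^-1 * d) => p; move wE : (u * d) => w.
have G1 : (gromov v^-1 p + gromov v d = len v)%N.
  by have := gromov_mulr v^-1 d; rewrite invgK lenV pE.
have G2 : (gromov u w + gromov u^-1 d = len u)%N by rewrite -wE gromov_mulr.
have Lw : (len w + 2 * gromov u^-1 d = len u + len d)%N.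
  by rewrite -wE len_mul.
have Lp : (len p + 2 * gromov v d = len v + len d)%N.
  by rewrite -pE len_gromov.
have <- : d^-1 * w = d^-1 * u * d by rewrite -wE mulgA.
have <- : p^-1 * w = d^-1 * (v * u) * d.
  by rewrite -pE -wE invgM invgK !mulgA.
have Ldw := len_gromov d w; have Lpw := len_gromov p w.
have U1 := gromov_ultrametric p v^-1 u.
have U2 := gromov_ultrametric p u w.
rewrite kE [gromov p v^-1]gromovC in U1.
rewrite [gromov u^-1 d]gromovC du in G2 Lw.
rewrite [gromov v d]gromovC in G1 Lp.
by lia.
Qed.

Definition letter (x : T * bool) : FG := FreeGroup (isT : reduced [:: x]).

(** In the product of the values of the letters of a reduced word, the two
    neighbours of a factor never cancel all of it. *)
Definition rigid (f : T -> FG) := forall x y z : T * bool,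
  y <> inv_letter x -> z <> inv_letter y ->
  (gromov (letter_eval f x)^-1 (letter_eval f y)
   + gromov (letter_eval f y)^-1 (letter_eval f z) < len (letter_eval f y))%N.

(** By [gromov_mul_stable] only adjacent factors interact, and each of them
    keeps at least one letter. *)
Lemma rigid_len (f : T -> FG) (u : FG) : rigid f -> (len u <= len (fg_ext f u))%N.
Proof.
move=> rig; case: u => [[|x w] Hw]; first by rewrite /len.
rewrite /len -/(len (fg_ext f _)) /= /fg_ext /=.
set ev := foldr _ _.
(* The bound is strengthened by the part of the first factor that a preceding
   factor z could still cancel. *)
suff grow (z : T * bool) : x <> inv_letter z ->
    gromov (letter_eval f z)^-1 (letter_eval f x * ev w)
      = gromov (letter_eval f z)^-1 (letter_eval f x) /\
    (gromov (letter_eval f z)^-1 (letter_eval f x) + (size w).+1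
      <= len (letter_eval f x * ev w))%N.
  have [|_] := grow x; last by lia.
  by case: (x) => t [].
elim: w x Hw z => [|y w IH] x Hw z xz.
  rewrite /ev /= mulg1; split=> //.
  have xx : x <> inv_letter x by case: (x) => t [].
  by have := rig z x x xz xx; lia.
have [yx Hyw] : y <> inv_letter x /\ reduced (y :: w).
  by move: Hw => /= /andP[/eqP].
have [gx lx] := IH y Hyw x yx.
have rz := rig z x y xz yx.
have -> : ev (y :: w) = letter_eval f y * ev w by [].
move: (letter_eval f y * ev w) gx lx => v gx lx.
split; first by apply: gromov_mul_stable; rewrite gx.
by have := len_mul (letter_eval f x) v; rewrite gx /=; lia.
Qed.
End Length.

(** * Generators of the automorphism group of F2 *)

Definition gens (G : Type) (x y : G) (i : 'I_2) : G := if val i == 0%N then x else y.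
Definition ga : F2 := fg_gen (@Ordinal 2 0 isT).
Definition gb : F2 := fg_gen (@Ordinal 2 1 isT).

Lemma forall_gens (P : 'I_2 -> Prop) :
  P (@Ordinal 2 0 isT) -> P (@Ordinal 2 1 isT) -> forall i, P i.
Proof.
move=> P0 P1 [[|[|//]] Hi]; [move: P0 | move: P1];
 by congr P; apply: val_inj.
Qed.

Lemma aut_F2_ext (phi psi : aut F2) :
  phi ga = psi ga -> phi gb = psi gb -> phi = psi.
Proof. by move=> ea eb; apply: aut_ext; apply: forall_gens. Qed.

Lemma ext_ga (G : groupType) (x y : G) : fg_ext (gens x y) ga = x.
Proof. exact: fg_extE. Qed.
Lemma ext_gb (G : groupType) (x y : G) : fg_ext (gens x y) gb = y.
Proof. exact: fg_extE. Qed.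

Lemma gens0 (G : Type) (x y : G) : gens x y (@Ordinal 2 0 isT) = x. Proof. by []. Qed.
Lemma gens1 (G : Type) (x y : G) : gens x y (@Ordinal 2 1 isT) = y. Proof. by []. Qed.

Lemma swapK t : fg_ext (gens gb ga) (gens gb ga t) = fg_gen t.
Proof. by move: t; apply: forall_gens; rewrite ?ext_ga ?ext_gb. Qed.
Definition swap : aut F2 := ext_aut swapK swapK.

Lemma flipK t : fg_ext (gens ga^-1 gb) (gens ga^-1 gb t) = fg_gen t.
Proof.
by move: t; apply: forall_gens; rewrite ?gens0 ?gens1 ?fg_extV ?ext_ga ?ext_gb ?invgK.
Qed.
Definition flip : aut F2 := ext_aut flipK flipK.

Lemma shearK t : fg_ext (gens ga (gb * ga)) (gens ga (gb * ga^-1) t) = fg_gen t.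
Proof.
move: t; apply: forall_gens;
by rewrite ?gens0 ?gens1 ?fg_extM ?fg_extV ?ext_ga ?ext_gb ?mulgK.
Qed.
Lemma shearVK t : fg_ext (gens ga (gb * ga^-1)) (gens ga (gb * ga) t) = fg_gen t.
Proof.
move: t; apply: forall_gens;
by rewrite ?gens0 ?gens1 ?fg_extM ?fg_extV ?ext_ga ?ext_gb ?mulgVK.
Qed.
Definition shear : aut F2 := ext_aut shearK shearVK.

Arguments swap : simpl never.
Lemma swapE : (swap ga = gb) * (swap gb = ga).
Proof. by split; [exact: ext_ga | exact: ext_gb]. Qed.
Arguments flip : simpl never.
Lemma flipE : (flip ga = ga^-1) * (flip gb = gb).
Proof. by split; [exact: ext_ga | exact: ext_gb]. Qed.
Arguments shear : simpl never.
Lemma shearE : (shear ga = ga) * (shear gb = gb * ga).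
Proof. by split; [exact: ext_ga | exact: ext_gb]. Qed.

Lemma letter_evalE (x : 'I_2 * bool) : letter_eval (@fg_gen _) x = letter x :> F2.
Proof. by case: x => t [] //=; apply: val_inj. Qed.

Section Nielsen.
Variable P : aut F2 -> Prop.
Hypothesis PM : forall f g, P f -> P g -> P (f * g).
Hypothesis PV : forall f, P f -> P f^-1.
Hypothesis Pinner : forall g, P (inner g).
Hypothesis Pswap : P swap.
Hypothesis Pflip : P flip.
Hypothesis Pshear : P shear.

Local Notation L phi := (len (phi ga) + len (phi gb))%N.

(** The eight signed permutations of the basis make it possible to assume that
    two given letters of distinct generators are the basis itself. *)
Lemma signed_perm (x y : 'I_2 * bool) : x.1 <> y.1 ->
  exists k : aut F2, [/\ P k, k ga = letter y & k gb = letter x].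
Proof.
move=> xy.
have P1 : P 1 by rewrite -(mulgV swap); apply: PM => //; apply: PV.
pose fa (b : bool) : aut F2 := if b then flip else 1.
have Pfa b : P (fa b) by case: b.
have faE b : (fa b ga = if b then ga^-1 else ga) * (fa b gb = gb).
  by split; case: b; rewrite /fa ?flipE ?aut1E.
pose fb b := swap * fa b * swap.
have Pfb b : P (fb b) by apply: PM => //; apply: PM.
have fbE b : (fb b ga = ga) * (fb b gb = if b then gb^-1 else gb).
  split; rewrite /fb !autM swapE faE ?swapE //.
  by case: b; rewrite ?autV ?swapE.
pose s (i : 'I_2) : aut F2 := if val i == 0%N then 1 else swap.
have Ps i : P (s i) by rewrite /s; case: ifP.
have sE i j : i <> j -> s j ga = fg_gen j /\ s j gb = fg_gen i.
  move: i j; apply: forall_gens; apply: forall_gens => // _.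
  by split; [exact: ext_ga | exact: ext_gb].
have [sa sb] := sE _ _ xy.
clearbody s fb fa.
exists (s y.1 * fa y.2 * fb x.2); split; first by do !apply: PM.
  rewrite !autM fbE faE -letter_evalE /letter_eval.
  by case: (y.2); rewrite ?autV sa.
rewrite !autM fbE -letter_evalE /letter_eval.
by case: (x.2); rewrite ?autV ?faE sb.
Qed.

(** One step of the reduction: a shear of the basis, followed by a conjugation
    in the target. *)
Lemma reduction_step (psi : aut F2) d :
  (forall chi : aut F2, (L chi < L psi)%N -> P chi) ->
  (len (d^-1 * psi ga * d) + len (d^-1 * (psi gb * psi ga) * d) < L psi)%N ->
  P psi.
Proof.
move=> IH lt; set chi := inner d^-1 * psi * shear.
have -> : psi = (inner d^-1)^-1 * chi * shear^-1.
  by rewrite /chi !mulgA mulVg mul1g mulgK.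
apply: (PM (PM _ _) _); [exact: PV | apply: IH | exact: PV].
by rewrite /chi !autM !shearE /= !aut_morph !invgK.
Qed.

(** Induction on the total length of the images of the basis. If no product of
    the images of two letters of distinct generators is shorter than its first
    factor, then at most half of each image cancels on either side, so only a
    tie, half on the left and half on the right, can prevent rigidity, and
    [tie_shortens] removes it. For a rigid phi, [rigid_len] shows that the
    elements sent to the two generators have length 1. *)
Theorem Nielsen_F2 phi : P phi.
Proof.
have [n le_n] := ubnP (L phi).
elim: n => // n IHn in phi le_n *.
have IH (k chi : aut F2) : L (phi * k) = L phi ->
  (L chi < L (phi * k))%N -> P chi by move=> -> lt; apply: IHn; lia.
have undo k : P k -> P (phi * k) -> P phi.
  by move=> Pk Ppk; rewrite -(mulgK k phi); apply: PM => //; apply: PV.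
pose f i := phi (fg_gen i).
have fE (x : 'I_2 * bool) : phi (letter x) = letter_eval f x.
  by rewrite -letter_evalE; case: x => t [] //=; rewrite /letter_eval /= autV.
have fV (x : 'I_2 * bool) : letter_eval f (inv_letter x) = (letter_eval f x)^-1.
  exact: letter_evalV.
have f_neq1 x : letter_eval f x <> 1.
  by rewrite -fE -(autf1 phi) => /(bij_inj (aut_bij phi)) /(congr1 (@word_of _)).
(* Lengths of the images of letters, and cancellation between two of them. *)
pose l x := len (letter_eval f x).
pose c x y := gromov (letter_eval f x)^-1 (letter_eval f y).
have lV x : l (inv_letter x) = l x by rewrite /l fV lenV.
have cV x y : c (inv_letter y) (inv_letter x) = c x y.
  by rewrite /c !fV invgK gromovC.
have lM x y : (len (letter_eval f x * letter_eval f y) + 2 * c x y = l x + l y)%N.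
  exact: len_mul.
have lt_cc x : (2 * c x x < l x)%N by apply: gromovV_lt.
have c_ultra x y : (minn (c y (inv_letter x)) (c x y) <= c y y)%N.
  by rewrite /c fV; apply: gromov_ultrametric.
have Lperm (x y : 'I_2 * bool) : x.1 <> y.1 -> (l x + l y = L phi)%N.
  have lenf z : l z = len (phi (fg_gen z.1)) by case: z => t [] //; apply: lenV.
  rewrite !lenf; case: x y => [i ?] [j ?] /=; move: i j.
  apply: forall_gens; apply: forall_gens => // _.
  exact: addnC.
case: (pselect (exists x y : 'I_2 * bool, x.1 <> y.1 /\
  (len (letter_eval f x * letter_eval f y) < l x)%N)).
  case=> x [y [xy lt]]; have [k [Pk ka kb]] := signed_perm xy.
  apply: (undo k) => //; apply: (@reduction_step _ 1).
    move=> chi; apply: IH; rewrite !autM ka kb !fE addnC; exact: Lperm.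
  rewrite invg1 !mul1g !mulg1 !autM ka kb !fE ltn_add2l; exact: lt.
move=> noshort.
have short (x y : 'I_2 * bool) : x.1 <> y.1 -> (2 * c x y <= l y)%N.
  move=> xy; have := lM x y.
  case: (ltnP (len (letter_eval f x * letter_eval f y)) (l x)); last by lia.
  by move=> lt; case: noshort; exists x, y.
have short' (x y : 'I_2 * bool) : x.1 <> y.1 -> (2 * c x y <= l x)%N.
  by move=> xy; rewrite -cV -lV; apply: short => /esym.
have same (x y : 'I_2 * bool) : x.1 = y.1 -> y <> inv_letter x -> x = y.
  by case: x y => [i []] [j []] /= <-.
case: (pselect (rigid f)) => [rig|nrig]; last first.
  have [x [y [xy tie1 tie2]]] : exists x y : 'I_2 * bool, [/\ x.1 <> y.1,
      (c x y + c x y = l y)%N & (c y x + c y x = l y)%N].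
    apply: contrapT => notie; apply: nrig => x y z yx zy.
    rewrite -/(c x y) -/(c y z) -/(l y).
    case: (eqVneq x.1 y.1) => [/same/(_ yx) -> | /eqP xy].
      case: (eqVneq y.1 z.1) => [/same/(_ zy) <- | /eqP yz].
        by have := lt_cc y; lia.
      by have := lt_cc y; have := short' y z yz; lia.
    have sxy := short x y xy.
    case: (eqVneq y.1 z.1) => [/same/(_ zy) <- | /eqP yz].
      by have := lt_cc y; lia.
    have syz := short' y z yz.
    (* Both c x y and c y z are at most half of l y, so failing means that
       both are exactly half. *)
    case: (pselect (z = x)) => [zx | /eqP zx].
      case: (ltnP (c x y + c y z) (l y)) => // ge; case: notie.
      by exists x, y; rewrite zx in syz ge; split=> //; lia.
    (* In this case the image of y would begin with half of its own inverse. *)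
    have zVx : z = inv_letter x.
      move: xy yz zx; clear; move: x y z => [i b] [j d] [k e] /=.
      rewrite /inv_letter /=; move: i j k; do 3!apply: forall_gens => //;
      by case: b e => [] [].
    by have := c_ultra x y; have := lt_cc y; rewrite -zVx; lia.
  have [k [Pk ka kb]] := signed_perm xy.
  apply: (undo k) => //.
  have le_yx : (l y <= l x)%N.
    by have := short y x (fun e => xy (esym e)); lia.
  have [d ltd] := tie_shortens (@f_neq1 y) tie1 tie2 le_yx.
  apply: (@reduction_step _ d).
    move=> chi; apply: IH; rewrite !autM ka kb !fE addnC; exact: Lperm.
  by rewrite !autM ka kb !fE.
have phiE : phi =1 fg_ext f.
  by apply: eq_on_gens (aut_morph phi) (fg_extM f) _ => t; rewrite fg_extE.
(* Each generator is the image of a single letter. *)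
have pre (t : 'I_2) : exists x, phi (letter x) = fg_gen t.
  have := rigid_len (phi^-1 (fg_gen t)) rig.
  rewrite -phiE -autM mulgV aut1E.
  have : phi^-1 (fg_gen t) <> 1.
    move=> /(congr1 phi); rewrite -autM mulgV aut1E autf1.
    by move=> /(congr1 (@word_of _)).
  case E: (phi^-1 (fg_gen t)) => [[|x [|? ?]] Hw] //; first by case; apply: val_inj.
  move=> _ _; exists x.
  have <- : phi (phi^-1 (fg_gen t)) = fg_gen t by rewrite -autM mulgV.
  by rewrite E; congr (phi _); apply: val_inj.
have [y ya] := pre (@Ordinal 2 0 isT); have [x xb] := pre (@Ordinal 2 1 isT).
have xy : x.1 <> y.1.
  move=> xy; case: (pselect (y = inv_letter x)) => [yx|/(same _ _ xy) e].
    by move: ya; rewrite yx fE fV -fE xb => /(congr1 (@word_of _)).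
  by move: ya; rewrite -e xb => /(congr1 (@word_of _)).
have [k [Pk ka kb]] := signed_perm xy.
apply: (undo k) => //; have -> : phi * k = 1.
  by apply: aut_F2_ext; rewrite autM ?ka ?kb.
by rewrite -(mulgV swap); apply: PM => //; apply: PV.
Qed.
End Nielsen.

(** If h is not 1, let x be a letter of the generator that does not occur in
    the first letter of h. Then x * h begins with x, whereas h * x still begins
    with the first letter of h; so h does not commute with x. *)
Lemma inner_eq1 (h : F2) : inner h = 1 -> h = 1.
Proof.
move=> h1; have comm x : h * x = x * h.
  have := congr1 (fun f : aut F2 => f x) h1; rewrite /= => E.
  by rewrite -{2}E mulgVK.
apply: contrapT => h_neq1.
have [t /= neq_t] : exists t : 'I_2, forall b, gromov h (letter (t, b)) = 0%N.
  case: h h_neq1 {h1 comm} => [[|[c b] w] Hw] /=; first by case; apply: val_inj.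
  move=> _; exists (if val c == 0%N then @Ordinal 2 1 isT else @Ordinal 2 0 isT).
  by move=> b'; rewrite /gromov /= xpair_eqE; case: c {Hw} => [[|[|//]] ?].
pose x : F2 := letter (t, false).
have xV : x^-1 = letter (t, true) by apply: val_inj.
have hx : gromov h x = 0%N := neq_t false.
have hxV : gromov x^-1 h = 0%N by rewrite xV gromovC; apply: neq_t.
have lx : len x = 1%N by [].
have lh := len_gt0 h_neq1.
have e1 : (gromov x (x * h) + gromov x^-1 h = len x)%N := gromov_mulr x h.
have e2 : (gromov h (x * h) + gromov h^-1 x = len h)%N.
  by rewrite -comm; apply: gromov_mulr.
have e3 : (len (x * h) + 2 * gromov h^-1 x = len h + len x)%N.
  by rewrite -comm; apply: len_mul.
have e4 : (len (x * h) + 2 * gromov x^-1 h = len x + len h)%N := len_mul x h.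
have := gromov_ultrametric h (x * h) x; rewrite [gromov (x * h) x]gromovC hx.
rewrite hxV in e1 e4; move: e1 e2 e3 e4 lh lx.
by lia.
Qed.

(** * Positive braid words on four strands *)

Variant braid_gen := sigma1 | sigma2 | sigma3.

Definition braided (G : groupType) (s : braid_gen -> G) :=
  [/\ s sigma1 * s sigma2 * s sigma1 = s sigma2 * s sigma1 * s sigma2,
      s sigma2 * s sigma3 * s sigma2 = s sigma3 * s sigma2 * s sigma3 &
      s sigma1 * s sigma3 = s sigma3 * s sigma1].

Definition braid_eval (G : groupType) (s : braid_gen -> G) (w : seq braid_gen) : G :=
  foldr (fun i g => s i * g) 1 w.

Definition far i j := (i = sigma1 /\ j = sigma3) \/ (i = sigma3 /\ j = sigma1).
Definition adjacent i j := i <> j /\ ~ far i j.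

(** Equality in the positive braid monoid. It is not defined by evaluation in
    groups, because it has to be respected by the singular matrices obtained
    at t = 0. *)
Inductive braid_eq : seq braid_gen -> seq braid_gen -> Prop :=
| braid_eq_refl w : braid_eq w w
| braid_eq_trans v u w : braid_eq u v -> braid_eq v w -> braid_eq u w
| braid_eq_cons i u v : braid_eq u v -> braid_eq (i :: u) (i :: v)
| braid_eq_far i j w : far i j -> braid_eq [:: i, j & w] [:: j, i & w]
| braid_eq_adjacent i j w :
    adjacent i j -> braid_eq [:: i, j, i & w] [:: j, i, j & w].

Lemma braid_eq_sym u v : braid_eq u v -> braid_eq v u.
Proof.
elim=> [w|v1 u1 w1 _ IH1 _ IH2|i u1 v1 _ IH|i j w ij|i j w [ij nfar]].
- exact: braid_eq_refl.
- exact: braid_eq_trans IH2 IH1.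
- exact: braid_eq_cons.
- by apply: braid_eq_far; case: ij => -[-> ->]; [right | left].
apply: braid_eq_adjacent; split=> [ji|fji]; first exact: ij.
by apply: nfar; case: fji => -[-> ->]; [right | left].
Qed.

(** The full twist, the fourth power of delta, is central; [twist_div i] is its
    quotient by the i-th generator. *)
Definition delta := [:: sigma1; sigma2; sigma3].
Definition twist n := flatten (nseq n (delta ++ delta ++ delta ++ delta)).
Definition twist_div i :=
  match i with
  | sigma1 => [:: sigma2; sigma3] ++ delta ++ delta ++ delta
  | sigma2 => delta ++ [:: sigma2; sigma3] ++ delta ++ delta
  | sigma3 => delta ++ delta ++ [:: sigma2; sigma3] ++ delta
  end.

Section Braided.
Variables (G : groupType) (s : braid_gen -> G).
Hypothesis sB : braided s.
Local Notation x := (s sigma1).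
Local Notation y := (s sigma2).
Local Notation z := (s sigma3).

Lemma braid_eval_cat u v : braid_eval s (u ++ v) = braid_eval s u * braid_eval s v.
Proof. by elim: u => [|i u IH] /=; rewrite ?mul1g // IH mulgA. Qed.

Lemma braid12 g : x * (y * (x * g)) = y * (x * (y * g)).
Proof. by case: sB => e _ _; rewrite !mulgA e. Qed.
Lemma braid23 g : y * (z * (y * g)) = z * (y * (z * g)).
Proof. by case: sB => _ e _; rewrite !mulgA e. Qed.
Lemma braid13 g : x * (z * g) = z * (x * g).
Proof. by case: sB => _ _ e; rewrite !mulgA e. Qed.

Lemma braid_eval_braid_eq u v : braid_eq u v -> braid_eval s u = braid_eval s v.
Proof.
elim=> [w|v1 u1 w1 _ -> _ ->|i u1 v1 _ /= ->|i j w|i j w] //=.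
  by case=> -[-> ->]; rewrite braid13.
case: i j => [] [] [neq nfar]; rewrite ?braid12 ?braid23 //;
by case: nfar; rewrite /far; auto.
Qed.

Local Notation d := (braid_eval s delta).

Lemma deltaE g : d * g = x * (y * (z * g)).
Proof. by rewrite /= mulg1 !mulgA. Qed.

(** Conjugation by delta shifts sigma1 to sigma2 and sigma2 to sigma3, and its
    square brings sigma3 back to sigma1; so its fourth power is central. The
    trailing factor g keeps all these identities usable inside products. *)
Lemma delta1 g : d * (x * g) = y * (d * g).
Proof. by rewrite !deltaE -braid13 braid12. Qed.

Lemma delta2 g : d * (y * g) = z * (d * g).
Proof. by rewrite !deltaE braid23 braid13. Qed.

Lemma delta3 g : d * (d * (z * g)) = x * (d * (d * g)).
Proof.
rewrite !deltaE; congr (_ * _).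
by rewrite -braid13 -braid23 -braid12 -braid13.
Qed.

Lemma twistE g : braid_eval s (twist 1) * g = d * (d * (d * (d * g))).
Proof. by rewrite /twist /= mulg1 !mulgA. Qed.

Lemma twistC i g :
  braid_eval s (twist 1) * (s i * g) = s i * (braid_eval s (twist 1) * g).
Proof.
rewrite !twistE; case: i.
- by rewrite delta1 delta2 delta3.
- by rewrite delta2 delta3 delta1.
- by rewrite delta3 delta1 delta2.
Qed.

Lemma twistS n g : braid_eval s (twist n.+1) * g =
  braid_eval s (twist 1) * (braid_eval s (twist n) * g).
Proof.
have -> : twist n.+1 = twist 1 ++ twist n by rewrite /twist /= ?cats0.
by rewrite braid_eval_cat mulgA.
Qed.

Lemma twist_comm n i g :
  braid_eval s (twist n) * (s i * g) = s i * (braid_eval s (twist n) * g).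
Proof.
by elim: n g => [|n IH] g; [rewrite !mul1g | rewrite twistS IH twistC -twistS].
Qed.

Lemma twist_divE i g :
  s i * (braid_eval s (twist_div i) * g) = braid_eval s (twist 1) * g.
Proof.
rewrite twistE; case: i.
- by rewrite (deltaE (d * _)) /= !mulg1 !mulgA.
- transitivity (y * (d * (y * (z * (d * (d * g)))))).
    by rewrite /= !mulg1 !mulgA.
  by rewrite -delta1 (deltaE (d * (d * g))).
- transitivity (z * (d * (d * (y * (z * (d * g)))))).
    by rewrite /= !mulg1 !mulgA.
  by rewrite -delta2 -delta1 (deltaE (d * g)).
Qed.

Lemma fraction_cons n i g u : braid_eval s (twist n) * g = braid_eval s u ->
  braid_eval s (twist n) * (s i * g) = braid_eval s (i :: u).
Proof. by move=> E; rewrite twist_comm E. Qed.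

Lemma fraction_consV n i g u : braid_eval s (twist n) * g = braid_eval s u ->
  braid_eval s (twist n.+1) * ((s i)^-1 * g) = braid_eval s (twist_div i ++ u).
Proof.
move=> E; apply: (@mulgI _ (s i)); rewrite -twist_comm mulVKg.
by rewrite twistS E braid_eval_cat twist_divE.
Qed.

(** These two elements generate the kernel of the homomorphism from B4 to B3
    that identifies sigma1 with sigma3. *)
Definition braid_a := x * z^-1.
Definition braid_b := y * braid_a * y^-1.

Lemma braid13V g : x * (z^-1 * g) = z^-1 * (x * g).
Proof. by apply: (@mulgI _ z); rewrite -braid13 !mulVKg. Qed.

Lemma s1_a : x * braid_a = braid_a * x.
Proof. by rewrite /braid_a -mulgA; have := braid13V 1; rewrite !mulg1 => ->. Qed.

Lemma s1_b : x * braid_b = braid_b * braid_a^-1 * x.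
Proof.
rewrite /braid_b /braid_a !invgM !invgK -!mulgA mulVg mulg1 braid12.
do 2!congr (_ * _); apply: (@mulgI _ z); apply: (@mulgI _ y).
by rewrite braid23 !mulVKg mulgV mulg1.
Qed.

Definition quarter_turn := y * x * z.

Lemma quarter_a : quarter_turn * braid_a = braid_b * quarter_turn.
Proof.
rewrite /quarter_turn /braid_b /braid_a -!mulgA mulKg.
by rewrite -braid13V mulVg mulg1 -braid13 mulgV mulg1.
Qed.

Lemma quarter_b : quarter_turn * braid_b = braid_a^-1 * quarter_turn.
Proof.
rewrite /quarter_turn /braid_b /braid_a !invgM !invgK -!mulgA.
apply: (@mulgI _ x); rewrite [RHS]braid13 mulVKg.
apply: (@mulIg _ (y * z)); rewrite -!mulgA mulKg mulVg mulg1.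
case: (sB) => _ _ xz.
by rewrite braid12 braid23 -xz braid13 braid12 braid23 -braid13.
Qed.
End Braided.

Local Open Scope ring_scope.

(** * Linearity of a holomorph *)

Lemma spanning_basis (k : fieldType) (X : Type) (N : nat) (f : X -> 'rV[k]_N) :
  exists (m : nat) (x : 'I_m -> X),
    row_free (\matrix_i f (x i)) /\ forall y, (f y <= \matrix_i f (x i))%MS.
Proof.
(* d bounds the number of vectors that can still be adjoined. *)
suff H d m (x : 'I_m -> X) : row_free (\matrix_i f (x i)) -> (N <= d + m)%N ->
    exists (m : nat) (x : 'I_m -> X),
    row_free (\matrix_i f (x i)) /\ forall y, (f y <= \matrix_i f (x i))%MS.
  apply: (H N 0%N (fun i => False_rect X (notF (ltn_ord i)))).
    by rewrite /row_free -leqn0 rank_leq_row.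
  by rewrite addn0.
elim: d m x => [|d IHd] m x freeB leN; set B := \matrix_i f (x i) in freeB.
  exists m, x; split=> // y; apply: submx_full.
  by rewrite /row_full eqn_leq rank_leq_col (eqP freeB).
case: (pselect (forall y, (f y <= B)%MS)) => [|/existsNP[y /negP yB]].
  by exists m, x.
pose x' (i : 'I_(1 + m)) := if split i is inr j then x j else y.
apply: (IHd _ x'); last by rewrite addnA addn1.
have -> : \matrix_i f (x' i) = col_mx (f y) B.
  apply/row_matrixP => i; rewrite rowK /x' -[i]splitK.
  case: (split i) => j; rewrite unsplitK /=.
    by rewrite rowKu [j]ord1; apply/rowP => l; rewrite mxE.
  by rewrite rowKd rowK.
have ltB : (B < f y + B)%MS.
  by rewrite /ltmx addsmxSr addsmx_sub negb_and yB.
rewrite /row_free eqn_leq rank_leq_row /= -addsmxE.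
by move: ltB; rewrite ltmxErank (eqP freeB) => /andP[].
Qed.

(** The matrices T g need not be unique nor multiplicative. Their restrictions
    to the span of the values of f are determined by the action, and they
    compose. *)
Lemma linear_of_action (G : groupType) (X : Type) (act : G -> X -> X)
    (k : fieldType) (N : nat) (f : X -> 'rV[k]_N) :
    [pchar k] =i pred0 ->
    (forall x, act 1%g x = x) ->
    (forall g h x, act (g * h)%g x = act g (act h x)) ->
    (forall g, (forall x, act g x = x) -> g = 1%g) ->
    injective f ->
    (forall g, exists T, forall x, f (act g x) = f x *m T) ->
  linear_group G.
Proof.
move=> char0 act1 actM act_faithful f_inj /choice[T fT].
have [m [x [freeB fB]]] := spanning_basis f; set B := \matrix_i _ in freeB fB.
(* The matrix of T g in the basis B. Row vectors make M reverse products, so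
   the representation is the transpose of M. *)
pose M g := B *m T g *m pinvmx B.
have BT g : B *m T g = M g *m B.
  rewrite mulmxKpV //; apply/row_subP => i.
  by rewrite row_mul rowK -fT fB.
have M1 : M 1%g = 1%:M.
  apply: (row_free_inj freeB); rewrite -BT mul1mx.
  by apply/row_matrixP => i; rewrite row_mul rowK -fT act1.
have MM g h : M (g * h)%g = M h *m M g.
  apply: (row_free_inj freeB); rewrite -BT -mulmxA -BT mulmxA -BT.
  apply/row_matrixP => i; rewrite !row_mul !rowK -!fT actM //.
have unitM g : (M g)^T \in unitmx.
  rewrite unitmx_tr; case: (@mulmx1_unit _ _ (M g) (M g^-1%g)) => //.
  by rewrite -MM mulVg M1.
have [rho rhoE] : exists rho : {multiplicative G -> GL m k},
    rho =1 fun g => GLmx (unitM g).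
  apply: multiplicativeP => g h; apply: val_inj => /=.
  by rewrite MM trmx_mul.
exists m, k, rho; split=> // g h; rewrite !rhoE => /(congr1 val) /= /trmx_inj Mgh.
suff: (h^-1 * g = 1)%g.
  by move=> /(congr1 ( *%g h)); rewrite mulgA mulgV mul1g mulg1.
apply: act_faithful => y; apply: f_inj.
have /submxP[c cE] := fB y.
by rewrite fT cE -mulmxA BT MM Mgh -MM mulVg M1 mul1mx.
Qed.

Lemma GL_val_inj m (k : fieldType) (A B : GL m k) : mx_of_GL A = mx_of_GL B -> A = B.
Proof. exact: val_inj. Qed.

(** If phi is realised by conjugation by S, then (g, phi) acts on matrices by
    X |-> D g * S * X * S^-1. *)
Lemma hol_linear (G : groupType) (k : fieldType) (n : nat)
    (D : {multiplicative G -> GL n k}) :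
    [pchar k] =i pred0 -> injective D ->
    (forall phi : aut G, exists S : GL n k,
        forall g, D (phi g) = (S * D g * S^-1)%g) ->
  linear_group (hol G).
Proof.
move=> char0 D_inj D_char.
pose act (u : hol G) (x : G) := (hol_elt u * hol_aut u x)%g.
apply: (@linear_of_action _ _ act k _ (fun x => mxvec (D x))) => //.
- by move=> x; rewrite /act /= mul1g.
- by move=> u v x; rewrite /act /= aut_morph mulgA.
- move=> [g phi] fix1; have g1 : g = 1%g.
    by have := fix1 1%g; rewrite /act /= autf1 mulg1.
  congr Hol => //; apply: aut_eq => x.
  by have := fix1 x; rewrite /act /= g1 mul1g.
- by move=> x y /(can_inj mxvecK)/GL_val_inj/D_inj.
- move=> [g phi]; have [S DS] := D_char phi.
  exists (lin_mx (mulmxr (invmx S) \o mulmx (D g *m S))) => x.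
  rewrite mul_vec_lin /act /= gmulfM DS; congr mxvec => /=.
  by rewrite !mulmxA.
Qed.

(** * The Lawrence-Krammer matrices *)

(** Krammer's formulas. The basis consists of the vectors x_12, x_13, x_14, x_23,
    x_24, x_34, indexed by the positive roots of A3, the simple ones being
    x_12, x_23, x_34; the lists give the images of these vectors in this
    order. *)
Definition lk_image (R : nzRingType) (q t : R) (k : braid_gen) : seq (seq R) :=
  match k with
  | sigma1 => [:: [:: t * q ^+ 2; 0; 0; 0; 0; 0];
         [:: t * q * (q - 1); 0; 0; q; 0; 0];
         [:: t * q * (q - 1); 0; 0; 0; q; 0];
         [:: 0; 1; 0; 1 - q; 0; 0];
         [:: 0; 0; 1; 0; 1 - q; 0];
         [:: 0; 0; 0; 0; 0; 1]]
  | sigma2 => [:: [:: 1 - q; q; 0; 0; 0; 0];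
         [:: 1; 0; 0; t * q ^+ 2 * (q - 1); 0; 0];
         [:: 0; 0; 1; t * q * (q - 1) ^+ 2; 0; 0];
         [:: 0; 0; 0; t * q ^+ 2; 0; 0];
         [:: 0; 0; 0; t * q * (q - 1); 0; q];
         [:: 0; 0; 0; 0; 1; 1 - q]]
  | sigma3 => [:: [:: 1; 0; 0; 0; 0; 0];
         [:: 0; 1 - q; q; 0; 0; 0];
         [:: 0; 1; 0; 0; 0; t * q ^+ 3 * (q - 1)];
         [:: 0; 0; 0; 1 - q; q; 0];
         [:: 0; 0; 0; 1; 0; t * q ^+ 2 * (q - 1)];
         [:: 0; 0; 0; 0; 0; t * q ^+ 2]]
  end.

Definition LK (R : nzRingType) (q t : R) k : 'M[R]_6 :=
  \matrix_(i, j) (nth [::] (lk_image q t k) j)`_i.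

Lemma map_LK (R S : nzRingType) (f : {rmorphism R -> S}) (q t : R) k :
  map_mx f (LK q t k) = LK (f q) (f t) k.
Proof.
apply/matrixP => i j; rewrite !mxE; case: k => /=;
case: i => [[|[|[|[|[|[|//]]]]]] ? /=]; case: j => [[|[|[|[|[|[|//]]]]]] ? /=];
by rewrite ?(rmorph0, rmorph1, rmorphM, rmorphB, rmorphXn, rmorph1).
Qed.

Section LKRelations.
Variables (R : comNzRingType) (q t : R).

Ltac mx6_ring :=
  let i := fresh "i" in let j := fresh "j" in
  apply/matrixP => i j; do 4!rewrite ?mxE ?big_ord_recl ?big_ord0; rewrite /=;
  case: i => [[|[|[|[|[|[|//]]]]]] ? /=]; case: j => [[|[|[|[|[|[|//]]]]]] ? /=];
  ring.

Lemma LK_comm : LK q t sigma1 *m LK q t sigma3 = LK q t sigma3 *m LK q t sigma1.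
Proof. mx6_ring. Qed.

Lemma LK_braid12 :
  LK q t sigma1 *m LK q t sigma2 *m LK q t sigma1 =
  LK q t sigma2 *m LK q t sigma1 *m LK q t sigma2.
Proof. mx6_ring. Qed.

Lemma LK_braid23 :
  LK q t sigma2 *m LK q t sigma3 *m LK q t sigma2 =
  LK q t sigma3 *m LK q t sigma2 *m LK q t sigma3.
Proof. mx6_ring. Qed.

(** The generators satisfy (X - 1)(X + q)(X - t q^2) = 0, which exhibits their
    inverses. *)
Lemma LK_cubic k :
  LK q t k *m (LK q t k *m LK q t k - (1 - q + t * q ^+ 2) *: LK q t k
     + (t * q ^+ 2 * (1 - q) - q) *: 1%:M) = (- (t * q ^+ 3))%:M.
Proof.
case: k; mx6_ring.
Qed.
End LKRelations.

Lemma LK_unitmx (L : fieldType) (q t : L) k :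
  q != 0 -> t != 0 -> LK q t k \in unitmx.
Proof.
move=> q0 t0; have := LK_cubic q t k; move: (_ + _ *: _) => N.
have : - (t * q ^+ 3) != 0 by rewrite oppr_eq0 mulf_neq0 ?expf_neq0.
move: (- _) => c c0 E.
suff : LK q t k *m (c^-1 *: N) = 1%:M by case/mulmx1_unit.
by rewrite -scalemxAr E scale_scalar_mx mulVf.
Qed.

Definition LKword (R : nzRingType) (q t : R) (w : seq braid_gen) : 'M[R]_6 :=
  foldr (fun k M => LK q t k *m M) 1%:M w.

Lemma map_LKword (R S : nzRingType) (f : {rmorphism R -> S}) (q t : R) w :
  map_mx f (LKword q t w) = LKword (f q) (f t) w.
Proof. by elim: w => [|k w IH] /=; rewrite ?map_mx1 // map_mxM map_LK IH. Qed.

Lemma LKword_braid_eq (R : comNzRingType) (q t : R) u v :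
  braid_eq u v -> LKword q t u = LKword q t v.
Proof.
elim=> [w|v1 u1 w1 _ -> _ ->|i u1 v1 _ /= ->|i j w|i j w] //=.
  by rewrite !mulmxA => -[] [-> ->]; rewrite LK_comm.
case: i j => [] [] [neq nfar]; rewrite !mulmxA ?LK_braid12 ?LK_braid23 //;
by case: nfar; rewrite /far; auto.
Qed.

Lemma braid_eq_size u v : braid_eq u v -> size u = size v.
Proof. by elim=> [w|v1 u1 w1 _ -> _ ->|i u1 v1 _ /= ->|i j w|i j w]. Qed.

(** * Positive words and the matrices at t = 0 *)

Section AtZero.
Variables (F : realFieldType) (q : F).
Hypotheses (q_gt0 : 0 < q) (q_lt1 : q < 1).

Local Notation o k := (@Ordinal 6 k isT).

Lemma mulmx6E (A B : 'M[F]_6) r c : (A *m B) r c =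
  A r (o 0) * B (o 0) c + A r (o 1) * B (o 1) c + A r (o 2) * B (o 2) c +
  A r (o 3) * B (o 3) c + A r (o 4) * B (o 4) c + A r (o 5) * B (o 5) c.
Proof.
rewrite mxE !big_ord_recl big_ord0 addr0 !addrA.
by do 5?congr (_ + _); congr (A _ _ * B _ _); apply: val_inj.
Qed.

Definition simple_root (i : braid_gen) : 'I_6 :=
  match i with sigma1 => o 0 | sigma2 => o 3 | sigma3 => o 5 end.

Lemma LK0_ge0 k r c : 0 <= LK q 0 k r c.
Proof.
rewrite mxE; case: k => /=;
case: r => [[|[|[|[|[|[|//]]]]]] ? /=]; case: c => [[|[|[|[|[|[|//]]]]]] ? /=];
by do ?rewrite mul0r; rewrite ?lexx ?ler01 ?subr_ge0 ?ltW.
Qed.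

Lemma LKword0_ge0 w r c : 0 <= LKword q 0 w r c.
Proof.
elim: w r c => [|k w IH] r c /=; first by rewrite mxE; case: eqP.
by rewrite mxE; apply: sumr_ge0 => i _; rewrite mulr_ge0 ?LK0_ge0.
Qed.

(** At t = 0 the k-th generator maps into the span of the roots other than the
    k-th simple one. *)
Lemma LK0_root_row k (M : 'M[F]_6) c : (LK q 0 k *m M) (simple_root k) c = 0.
Proof. by rewrite mulmx6E !mxE; case: k => /=; ring. Qed.

Lemma LK0_far_row i j (M : 'M[F]_6) c : far i j ->
  (LK q 0 j *m M) (simple_root i) c = M (simple_root i) c.
Proof. by rewrite mulmx6E !mxE => -[[-> ->]|[-> ->]] /=; ring. Qed.

(** The row r is that of the sum of the simple roots i and j. *)
Lemma LK0_adjacent_row i j : adjacent i j -> exists r (x y : F), [/\ 0 < x, 0 < y,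
  forall (M : 'M[F]_6) c,
    (LK q 0 j *m M) (simple_root i) c = (1 - q) * M (simple_root i) c + x * M r c &
  forall (M : 'M[F]_6) c, (LK q 0 i *m M) r c = y * M (simple_root j) c].
Proof.
case: i j => [] [] [neq nfar]; (try by case: neq);
  (try by case: nfar; rewrite /far; auto).
- exists (o 1), 1, 1; split; rewrite ?ltr01 // => M c;
  by rewrite mulmx6E !mxE /=; ring.
- exists (o 1), q, q; split; rewrite ?ltr01 // => M c;
  by rewrite mulmx6E !mxE /=; ring.
- exists (o 4), 1, 1; split; rewrite ?ltr01 // => M c;
  by rewrite mulmx6E !mxE /=; ring.
- exists (o 4), q, q; split; rewrite ?ltr01 // => M c;
  by rewrite mulmx6E !mxE /=; ring.
Qed.

(** Induction on w = j :: v. If j is far from i, the row of i is the same for v.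
    If j is adjacent to i, the row of i is a positive combination of two rows
    of v, so by nonnegativity both vanish. The first gives v = i :: v1; then
    the second is a multiple of the row of j for v1, so v1 = j :: v2 and
    w = j i j v2 = i j i v2. *)
Theorem LK0_row_initial w i : (forall c, LKword q 0 w (simple_root i) c = 0) ->
  exists2 w', size w = (size w').+1 & braid_eq w (i :: w').
Proof.
have [n] := ubnP (size w); elim: n => // n IH in w i *.
case: w => [|j w] /= lt_n row0.
  by have /eqP := row0 (simple_root i); rewrite mxE eqxx oner_eq0.
have [->|neq] := pselect (i = j); first by exists w => //; apply: braid_eq_refl.
have lt_w : (size w < n)%N by [].
have [fij|nfar] := pselect (far i j).
  have row_w c : LKword q 0 w (simple_root i) c = 0.
    by rewrite -(LK0_far_row _ _ fij) row0.
  have [w' sw w'E] := IH w i lt_w row_w.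
  exists (j :: w'); first by rewrite /= sw.
  apply: braid_eq_trans (braid_eq_cons j w'E) _.
  by apply: braid_eq_far; case: fij => -[-> ->]; [right | left].
have adj : adjacent i j by [].
have [r [x [y [x_gt0 y_gt0 rowj rowi]]]] := LK0_adjacent_row adj.
have row_w c : LKword q 0 w (simple_root i) c = 0 /\ LKword q 0 w r c = 0.
  have := row0 c; rewrite rowj => /eqP.
  have q1 : 0 < 1 - q by rewrite subr_gt0.
  rewrite paddr_eq0 ?mulr_ge0 ?LKword0_ge0 ?ltW // !mulf_eq0.
  by rewrite (gt_eqF q1) (gt_eqF x_gt0) => /andP[/eqP-> /eqP->].
have [w1 sw1 w1E] := IH w i lt_w (fun c => (row_w c).1).
have row_w1 c : LKword q 0 w1 (simple_root j) c = 0.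
  case: (row_w c) => _; rewrite (LKword_braid_eq _ _ w1E) /= rowi.
  by move/eqP; rewrite mulf_eq0 (gt_eqF y_gt0) => /eqP.
have lt_w1 : (size w1 < n)%N by rewrite -ltnS -sw1 ltnW.
have [w2 _ w2E] := IH w1 j lt_w1 row_w1.
exists [:: j, i & w2]; first by rewrite /= sw1 (braid_eq_size w2E).
apply: braid_eq_trans (braid_eq_cons j w1E) _.
apply: braid_eq_trans (braid_eq_cons j (braid_eq_cons i w2E)) _.
apply: braid_eq_adjacent; split=> [ji|fji]; first exact: neq.
by apply: nfar; case: fji => -[-> ->]; [right | left].
Qed.
End AtZero.

(** * Faithfulness on positive words *)

Local Notation K := {fraction {poly rat}}.
Definition half : {poly rat} := (2^-1)%:P.

Lemma tofrac_injective (R : idomainType) : injective (@tofrac R).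
Proof. by move=> x y /eqP; rewrite tofrac_eq => /eqP. Qed.

Lemma pchar_K : [pchar K] =i pred0.
Proof.
move=> p; rewrite inE /=; apply/negP => /andP[p_prime].
rewrite -[p%:R](rmorph_nat (@tofrac _)) tofrac_eq0 -polyC_natr polyC_eq0.
by rewrite pnatr_eq0; case: p p_prime.
Qed.

Lemma LK_unit k : LK (tofrac half) (tofrac 'X) k \in unitmx.
Proof. by apply: LK_unitmx; rewrite tofrac_eq0 ?polyX_eq0 ?polyC_eq0. Qed.

Definition sLK k : GL 6 K := GLmx (LK_unit k).

Lemma sLK_braided : braided sLK.
Proof.
split; apply: val_inj; [exact: LK_braid12 | exact: LK_braid23 | exact: LK_comm].
Qed.

Lemma val_braid_eval_sLK w :
  val (braid_eval sLK w) = map_mx (@tofrac _) (LKword half 'X w).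
Proof. by rewrite map_LKword; elim: w => //= k w ->. Qed.

Lemma horner0_LKword w :
  map_mx (horner_eval (0 : rat)) (LKword half 'X w) = LKword 2^-1 0 w.
Proof. by rewrite map_LKword /= /horner_eval hornerC hornerX. Qed.

(** Both words start, up to the braid relations, with the first letter of u,
    because this is visible on the rows at t = 0. It can be cancelled since
    the matrices are invertible over the field of fractions. *)
Theorem LK_faithful u v : braid_eval sLK u = braid_eval sLK v -> braid_eq u v.
Proof.
have q0 : 0 < 2^-1 :> rat by [].
have q1 : 2^-1 < 1 :> rat by [].
have at0 u1 v1 : braid_eval sLK u1 = braid_eval sLK v1 ->
    LKword (2^-1 : rat) 0 u1 = LKword 2^-1 0 v1.
  move=> /(congr1 val); rewrite !val_braid_eval_sLK => /matrixP E.
  rewrite -!horner0_LKword; congr map_mx; apply/matrixP => r c.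
  by apply: tofrac_injective; have := E r c; rewrite !mxE.
elim: u v => [|i u IH] v uv.
  case: v uv => [|j v] uv; first exact: braid_eq_refl.
  have : LKword (2^-1 : rat) 0 (j :: v) (simple_root j) (simple_root j) = 0.
    exact: LK0_root_row.
  rewrite -(at0 _ _ uv) mxE eqxx => /eqP.
  by rewrite oner_eq0.
have row_v c : LKword (2^-1 : rat) 0 v (simple_root i) c = 0.
  by rewrite -(at0 _ _ uv) LK0_root_row.
have [v' _ v'E] := LK0_row_initial q0 q1 row_v.
have E : braid_eval sLK u = braid_eval sLK v'.
  apply: (@mulgI _ (sLK i)); apply: etrans uv _.
  exact: braid_eval_braid_eq sLK_braided _ _ v'E.
apply: braid_eq_trans (braid_eq_cons i (IH _ E)) _.
exact: braid_eq_sym.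
Qed.

Local Close Scope ring_scope.

(** * The free group inside the braid group *)

Definition braid_F2 (G : groupType) (s : braid_gen -> G) (h : F2) : G :=
  fg_ext (gens (braid_a s) (braid_b s)) h.

(** X is a word in the generators and their inverses, seen as a function of the
    group in which it is evaluated; n and u do not depend on the group. *)
Definition fraction (X : forall G : groupType, (braid_gen -> G) -> G) :=
  exists n u, forall (G : groupType) (s : braid_gen -> G), braided s ->
    braid_eval s (twist n) * X G s = braid_eval s u.

Lemma fraction_gen i X : fraction X -> fraction (fun G s => s i * X G s).
Proof.
move=> [n [u E]]; exists n, (i :: u) => G s sB.
by apply: fraction_cons => //; apply: E.
Qed.

Lemma fraction_genV i X : fraction X -> fraction (fun G s => (s i)^-1 * X G s).
Proof.
move=> [n [u E]]; exists n.+1, (twist_div i ++ u) => G s sB.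
by apply: fraction_consV => //; apply: E.
Qed.

Lemma fraction_ext X Y : (forall G s, X G s = Y G s) -> fraction X -> fraction Y.
Proof. by move=> XY [n [u E]]; exists n, u => G s sB; rewrite -XY E. Qed.

Lemma fraction_letter x X : fraction X ->
  fraction (fun G s => letter_eval (gens (braid_a s) (braid_b s)) x * X G s).
Proof.
have F1 := @fraction_gen; have FV := @fraction_genV => FX.
rewrite /letter_eval /gens; case: x => t e /=.
case: (val t == 0%N); rewrite /braid_b /braid_a; case: e.
- apply: fraction_ext (F1 sigma3 _ (FV sigma1 _ FX)) => G s.
  by rewrite invgM invgK !mulgA.
- apply: fraction_ext (F1 sigma1 _ (FV sigma3 _ FX)) => G s.
  by rewrite !mulgA.
- apply: fraction_ext (F1 sigma2 _ (F1 sigma3 _ (FV sigma1 _ (FV sigma2 _ FX)))) => G s.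
  by rewrite !invgM !invgK !mulgA.
- apply: fraction_ext (F1 sigma2 _ (F1 sigma1 _ (FV sigma3 _ (FV sigma2 _ FX)))) => G s.
  by rewrite !mulgA.
Qed.

Lemma braid_F2_fraction (h : F2) : fraction (fun G s => braid_F2 s h).
Proof.
case: h => w Hw; rewrite /braid_F2 /fg_ext /= {Hw}.
elim: w => [|x w IH]; first by exists 0%N, [::] => G s _; rewrite mulg1.
exact: fraction_letter.
Qed.

(** If h is trivial under [sLK], then the positive words twist n and u have the
    same matrix, hence the same value for s. *)
Lemma braid_F2_kernel (h : F2) (G : groupType) (s : braid_gen -> G) :
  braided s -> braid_F2 sLK h = 1 -> braid_F2 s h = 1.
Proof.
move=> sB h1; have [n [u E]] := braid_F2_fraction h.
have := E _ _ sLK_braided; rewrite h1 mulg1 => /LK_faithful tu.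
by apply: (@mulgI _ (braid_eval s (twist n))); 
  rewrite E // mulg1 (braid_eval_braid_eq sB tu).
Qed.

Definition left_shear : aut F2 := inner ga * shear.

(** The action of B4 by conjugation on its free subgroup. The value at sigma2
    is dictated by the quarter turn being sigma2 sigma1 sigma3. *)
Definition B4_action : braid_gen -> aut F2 := fun i =>
  match i with
  | sigma1 => shear^-1
  | sigma2 => flip * swap * left_shear * shear
  | sigma3 => left_shear^-1
  end.

Lemma B4_action1 : (B4_action sigma1 ga = ga) * (B4_action sigma1 gb = gb * ga^-1).
Proof.
split; apply: aut_inv_eq; first by rewrite shearE.
by rewrite aut_morph autV !shearE mulgK.
Qed.

Lemma left_shearE : (left_shear ga = ga) * (left_shear gb = ga * gb).
Proof. by split; rewrite autM shearE /= ?mulgK // !mulgA mulgK. Qed.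

Lemma B4_action3 : (B4_action sigma3 ga = ga) * (B4_action sigma3 gb = ga^-1 * gb).
Proof.
split; apply: aut_inv_eq; first by rewrite left_shearE.
by rewrite aut_morph autV !left_shearE mulKg.
Qed.

Lemma B4_action2 :
  (B4_action sigma2 ga = gb) * (B4_action sigma2 gb = gb * ga^-1 * gb).
Proof.
rewrite /B4_action; move: left_shear left_shearE => ls lsE.
split; rewrite !autM !shearE ?aut_morph !lsE.
  by rewrite swapE flipE.
by rewrite (aut_morph swap) !swapE (aut_morph flip) !flipE.
Qed.

Lemma B4_action_braided : braided B4_action.
Proof.
split; apply: aut_F2_ext;
  move: B4_action B4_action1 B4_action2 B4_action3 => act e1 e2 e3;
  move: ga gb e1 e2 e3 => a b e1 e2 e3; rewrite !autM;
  do ?rewrite !(e1, e2, e3, aut_morph, autV);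
  rewrite ?invgM ?invgK; do ?rewrite mulgA;
  do ?rewrite (mulgK, mulgVK, mulgV, mulVg, mul1g); by [].
Qed.

Lemma braid_F2M (G : groupType) (s : braid_gen -> G) :
  {morph braid_F2 s : x y / x * y}.
Proof. exact: fg_extM. Qed.

Lemma braid_F2V (G : groupType) (s : braid_gen -> G) x :
  braid_F2 s x^-1 = (braid_F2 s x)^-1.
Proof. exact: fg_extV. Qed.

Lemma braid_F2_a (G : groupType) (s : braid_gen -> G) : braid_F2 s ga = braid_a s.
Proof. exact: ext_ga. Qed.
Lemma braid_F2_b (G : groupType) (s : braid_gen -> G) : braid_F2 s gb = braid_b s.
Proof. exact: ext_gb. Qed.

Lemma braid_F2_B4_action : braid_F2 B4_action =1 @inner F2.
Proof.
have Ba : braid_a B4_action = inner ga.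
  rewrite /braid_a /= invgK /left_shear -[shear in X in _ * X]invgK mulgA.
  rewrite inner_conj.
  by congr inner; rewrite B4_action1.
apply: eq_on_gens; [exact: braid_F2M | exact: innerM |].
apply: forall_gens; rewrite -/ga -/gb.
  by rewrite braid_F2_a Ba.
rewrite braid_F2_b /braid_b Ba inner_conj; congr inner.
by rewrite B4_action2.
Qed.

Lemma braid_F2_sLK_inj : injective (braid_F2 sLK).
Proof.
move=> g h gh; suff: h^-1 * g = 1.
  by move=> E; rewrite -[g](mulVKg h) E mulg1.
apply: inner_eq1; rewrite -braid_F2_B4_action.
apply: braid_F2_kernel B4_action_braided _.
by rewrite braid_F2M braid_F2V gh mulVg.
Qed.

(** * A representation of F2 stable under all automorphisms *)

Section Conjugators.
Variables (G : groupType) (s : braid_gen -> G).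
Hypothesis sB : braided s.

Lemma braid_F2_conj (phi : aut F2) (g : G) :
    braid_F2 s (phi ga) = g * braid_a s * g^-1 ->
    braid_F2 s (phi gb) = g * braid_b s * g^-1 ->
  forall h, braid_F2 s (phi h) = g * braid_F2 s h * g^-1.
Proof.
move=> Ea Eb; apply: eq_on_gens.
- by move=> x y; rewrite aut_morph braid_F2M.
- by move=> x y; rewrite braid_F2M !mulgA mulgVK.
by apply: forall_gens; rewrite -/ga -/gb ?braid_F2_a ?braid_F2_b.
Qed.

Lemma braid_F2_shear h :
  braid_F2 s (shear h) = (s sigma1)^-1 * braid_F2 s h * (s sigma1)^-1^-1.
Proof.
move: h; apply: braid_F2_conj; rewrite shearE ?braid_F2M ?braid_F2_a ?braid_F2_b invgK.
  by rewrite -mulgA -(s1_a sB) mulKg.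
apply: (@mulgI _ (s sigma1)); rewrite -[in RHS]mulgA mulVKg mulgA (s1_b sB).
by rewrite -mulgA (s1_a sB) mulgA mulgVK.
Qed.

Lemma braid_F2_quarter h :
  braid_F2 s ((flip * swap) h) = quarter_turn s * braid_F2 s h * (quarter_turn s)^-1.
Proof.
move: h; apply: braid_F2_conj; rewrite autM swapE flipE ?braid_F2V ?braid_F2_a ?braid_F2_b.
  by rewrite (quarter_a sB) mulgK.
by rewrite (quarter_b sB) mulgK.
Qed.
End Conjugators.

Section DirectSum.
Variable k : fieldType.
Local Open Scope ring_scope.

Lemma dsum_unit m n (A : GL m k) (B : GL n k) : block_mx A 0 0 B \in unitmx.
Proof. by rewrite unitmxE det_ublock unitrM -!unitmxE !mx_of_GL_unit. Qed.
Definition dsum m n (A : GL m k) (B : GL n k) : GL (m + n) k := GLmx (dsum_unit A B).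

Lemma dsumM m n (A A' : GL m k) (B B' : GL n k) :
  (dsum A B * dsum A' B' = dsum (A * A') (B * B'))%g.
Proof.
apply: val_inj; rewrite /= mulmx_block.
by rewrite !(mulmx0, mul0mx, addr0, add0r).
Qed.

Lemma dsumV m n (A : GL m k) (B : GL n k) : ((dsum A B)^-1 = dsum A^-1 B^-1)%g.
Proof.
apply: (@mulgI _ (dsum A B)); rewrite mulgV dsumM !mulgV.
by apply: val_inj => /=; rewrite -scalar_mx_block.
Qed.

Lemma exchange_sq n :
  (block_mx 0 1%:M 1%:M 0 : 'M[k]_(n + n)) *m block_mx 0 1%:M 1%:M 0 = 1%:M.
Proof.
by rewrite mulmx_block !(mulmx0, mul0mx, mulmx1, addr0, add0r) -scalar_mx_block.
Qed.
Lemma exchange_unit n : (block_mx 0 1%:M 1%:M 0 : 'M[k]_(n + n)) \in unitmx.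
Proof. by case/mulmx1_unit: (exchange_sq n). Qed.
Definition exchange n : GL (n + n) k := GLmx (exchange_unit n).

Lemma dsum_exchange n (A B : GL n k) :
  (dsum B A = exchange n * dsum A B * (exchange n)^-1)%g.
Proof.
apply: (@mulIg _ (exchange n)); rewrite mulgVK; apply: val_inj => /=.
by rewrite !mulmx_block !(mulmx0, mul0mx, mulmx1, mul1mx, addr0, add0r).
Qed.
End DirectSum.

Definition twin (h : F2) : GL (6 + 6) K :=
  dsum (braid_F2 sLK h) (braid_F2 sLK (flip h)).

Lemma twinM : {morph twin : g h / g * h}.
Proof. by move=> g h; rewrite /twin aut_morph !braid_F2M dsumM. Qed.

Definition twin_conj (phi : aut F2) :=
  exists S : GL (6 + 6) K, forall h, twin (phi h) = S * twin h * S^-1.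

Lemma flip_flip h : flip (flip h) = h.
Proof.
rewrite -autM -[RHS]aut1E; congr (aut_fun _ h).
apply: aut_F2_ext; rewrite autM; first by rewrite flipE autV flipE invgK.
by rewrite !flipE.
Qed.

(** As flip inverts phi under conjugation, the second summand rho o flip is
    conjugated by g^-1 where the first one is conjugated by g. *)
Lemma twin_conj_reversed (phi : aut F2) (g : GL 6 K) :
    (forall h, braid_F2 sLK (phi h) = g * braid_F2 sLK h * g^-1) ->
    phi * flip * phi = flip ->
  twin_conj phi.
Proof.
move=> phiE rev; exists (dsum g g^-1) => h.
rewrite dsumV /twin !dsumM phiE; congr dsum.
have -> : flip h = phi (flip (phi h)) by rewrite -[in LHS]rev !autM.
by rewrite phiE !mulgA mulVg mul1g !mulgK ?mulgVK.
Qed.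

Lemma twin_conj_all phi : twin_conj phi.
Proof.
have extM f g : twin_conj f -> twin_conj g -> twin_conj (f * g).
  move=> [S SE] [T TE]; exists (S * T) => h.
  by rewrite autM SE TE invgM !mulgA.
have extV f : twin_conj f -> twin_conj f^-1.
  move=> [S SE]; exists S^-1 => h; rewrite invgK.
  rewrite -[in RHS](aut1E h) -(mulgV f) autM SE.
  by rewrite !mulgA mulVg mul1g mulgVK.
have conj_flip : twin_conj flip.
  by exists (exchange K 6) => h; rewrite /twin flip_flip dsum_exchange.
apply: Nielsen_F2 => //.
- move=> g; exists (twin g) => h; rewrite /= !twinM; congr (_ * _).
  exact: morphV twinM g.
- have -> : swap = flip^-1 * (flip * swap) by rewrite mulKg.
  apply: extM; first exact: extV.
  apply: twin_conj_reversed (braid_F2_quarter sLK_braided) _.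
  apply: aut_F2_ext; rewrite !autM ?swapE ?flipE ?autV ?swapE ?flipE;
  by rewrite ?autV ?swapE ?flipE ?invgK.
apply: twin_conj_reversed (braid_F2_shear sLK_braided) _.
apply: aut_F2_ext; rewrite !autM !shearE ?flipE ?autV ?shearE //.
by rewrite aut_morph !flipE aut_morph autV !shearE mulgK.
Qed.

Theorem mainTheorem1 : linear_group (hol F2).
Proof.
have [D DE] := multiplicativeP twinM.
apply: (@hol_linear _ _ _ D pchar_K).
  move=> g h; rewrite !DE => /(congr1 val) /= /eq_block_mx[E _ _ _].
  by apply: braid_F2_sLK_inj; apply: val_inj.
by move=> phi; have [S SE] := twin_conj_all phi; exists S => h; rewrite !DE SE.
Qed.
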